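(* Let $M,\ell\ge 1$, let $\Psi\in\mathbb{R}^{M\times \ell}$, let $\Sigma_{\mathrm{pr}}\in\mathbb{R}^{\ell\times\ell}$ be symmetric positive definite, and let $\sigma_{\mathrm{ch}}>\sigma_{\exp}>0$. Let $S=[S_{\mathrm{ch}},S_{\exp}]$ be a selection list (pair of subsets of $\{1,\dots,M\}$) with $S_{\mathrm{ch}}\cap S_{\exp}=\emptyset$, and let $i\in\{1,2,\dots,M\}\setminus(S_{\mathrm{ch}}\cup S_{\exp})$ be a location not previously selected. Then $$\Phi_D\left(S^{(\mathrm{ch},i)}\right)\le\Phi_D\left(S^{(\exp,i)}\right).$$
   Context: Candidate sensor locations are $\{1,\dots,M\}$, and there are two sensor types (fidelities): cheap ($\mathrm{ch}$) and expensive ($\exp$), with measurement noise standard deviations $\sigma_{\mathrm{ch}}>\sigma_{\exp}>0$. $\Psi\in\mathbb{R}^{M\times\ell}$ is the modal basis restricted to the candidate locations and $\Sigma_{\mathrm{pr}}\in\mathbb{R}^{\ell\times\ell}$ is the (symmetric positive definite) prior covariance; $\Sigma_{\mathrm{pr}}^{1/2}$ is its symmetric positive definite square root. For a selection list $S=[S_{\mathrm{ch}},S_{\exp}]$ of disjoint subsets of $\{1,\dots,M\}$ put $k_j=|S_j|$. The selection matrix $\mathbf{S}_j\in\{0,1\}^{M\times k_j}$ consists of the columns of the $M\times M$ identity matrix indexed by $S_j$, and $\mathbf{S}=[\mathbf{S}_{\mathrm{ch}}\ \ \mathbf{S}_{\exp}]$. The noise covariance is the block-diagonal matrix $\Sigma_{\mathrm{noise}}=\mathrm{diag}(\sigma_{\mathrm{ch}}^2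 I_{k_{\mathrm{ch}}},\ \sigma_{\exp}^2 I_{k_{\exp}})$. The inverse posterior covariance is $$\Sigma_{\mathrm{post}}^{-1}(S)=\Psi^\top\mathbf{S}\,\Sigma_{\mathrm{noise}}^{-1}\,\mathbf{S}^\top\Psi+\Sigma_{\mathrm{pr}}^{-1},$$ and the D-optimality criterion is $$\Phi_D(S)=\log\det\left(\Sigma_{\mathrm{pr}}^{1/2}\,\Sigma_{\mathrm{post}}^{-1}(S)\,\Sigma_{\mathrm{pr}}^{1/2}\right).$$ Empty products (when $S_j=\emptyset$) contribute the zero matrix. For a location $i$, $S^{(\mathrm{ch},i)}=[S_{\mathrm{ch}}\cup\{i\},\,S_{\exp}]$ and $S^{(\exp,i)}=[S_{\mathrm{ch}},\,S_{\exp}\cup\{i\}]$. *)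

(* Defs.v *)
From mathcomp Require Import all_boot all_order all_algebra.
From mathcomp Require Import complex.
From mathcomp Require Import boolp classical_sets reals exp.
Set Implicit Arguments.
Unset Strict Implicit.
Unset Printing Implicit Defensive.
Import Order.TTheory GRing.Theory Num.Theory.
Local Open Scope ring_scope.

Definition posdefmx (R : realType) (n : nat) (A : 'M[R]_n) : Prop :=
  A^T = A /\ forall x : 'cV[R]_n, x != 0 -> 0 < (x^T *m A *m x) 0 0.

(* Total function: 0 when A has no positive definite square root.  By
   sqrtmxP and sqrtmx_uniq below, it is the unique such root as soon as A is
   positive definite. *)
Definition sqrtmx (R : realType) (n : nat) (A : 'M[R]_n) : 'M[R]_n :=
  xget 0 [set B : 'M[R]_n | posdefmx B /\ B *m B = A]%classic.

Lemma interp_seq (F : fieldType) (f : F -> F) (s : seq F) :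
  exists p : {poly F}, forall x, x \in s -> p.[x] = f x.
Proof.
elim: s => [|a s [q hq]]; first by exists 0.
have [as_|as_] := boolP (a \in s).
  by exists q => x; rewrite inE => /predU1P[->|]; exact: hq.
pose w := \prod_(b <- s) ('X - b%:P).
have wa : w.[a] != 0 by rewrite -rootE root_prod_XsubC.
exists (q + ((f a - q.[a]) / w.[a])%:P * w) => x.
rewrite inE !hornerE => /predU1P[->|xs]; first by rewrite divfK // addrC subrK.
have /eqP -> : w.[x] == 0 by rewrite -rootE root_prod_XsubC.
by rewrite mulr0 addr0 hq.
Qed.

Lemma posdefmx_row (R : realType) (n : nat) (A : 'M[R]_n) (v : 'rV[R]_n) :
  posdefmx A -> v != 0 -> 0 < (v *m A *m v^T) 0 0.
Proof.
move=> [_ hA] v0; have := hA v^T; rewrite trmxK; apply.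
by rewrite -(inj_eq (@trmx_inj _ _ _)) trmxK trmx0.
Qed.

Lemma dot_ge0 (R : realType) (n : nat) (v : 'rV[R]_n) : 0 <= (v *m v^T) 0 0.
Proof. by rewrite mxE sumr_ge0 // => i _; rewrite mxE -expr2 sqr_ge0. Qed.

Lemma dot_gt0 (R : realType) (n : nat) (v : 'rV[R]_n) :
  v != 0 -> 0 < (v *m v^T) 0 0.
Proof.
move=> v0; rewrite lt0r dot_ge0 andbT; apply: contra v0.
rewrite mxE psumr_eq0; last by move=> i _; rewrite mxE -expr2 sqr_ge0.
move=> /allP h; apply/eqP/rowP => i; have := h i (mem_index_enum _).
by rewrite !mxE -expr2 sqrf_eq0 => /eqP.
Qed.

Lemma posdefmx_eigenvalue (R : realType) (n : nat) (A : 'M[R]_n) (a : R) :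
  posdefmx A -> eigenvalue A a -> 0 < a.
Proof.
move=> hA /eigenvalueP[v vA v0]; have := posdefmx_row hA v0.
by rewrite vA -scalemxAl mxE pmulr_lgt0 // dot_gt0.
Qed.

Lemma posdefmx_root4 (R : realType) (n : nat) (A : 'M[R]_n.+1) :
  posdefmx A -> exists q : {poly R}, horner_mx A q ^+ 4 = A.
Proof.
move=> hA; pose phi := real_complex R; pose H := map_mx phi A.
have Hherm : H \is hermsymmx.
  apply: realsym_hermsym.
    apply/is_hermitianmxP; rewrite expr0 scale1r map_mx_id // map_trmx.
    by rewrite hA.1.
  by apply/mxOverP => i j; rewrite mxE; apply/complex_realP; exists (A i j).
have /orthomx_spectralP := hermitian_normalmx Hherm.
have := hermitian_spectral_diag_real Hherm.
have := spectral_unit H.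
move: (spectralmx H) (spectral_diag H) => P d Pu /mxOverP dreal HE.
pose e j : R := complex.Re (d 0 j).
have de j : d 0 j = phi (e j) by rewrite /phi /e RRe_real.
have e0 j : 0 < e j.
  apply: (posdefmx_eigenvalue hA).
  rewrite eigenvalue_root_char -(fmorph_root phi) map_char_poly.
  rewrite -eigenvalue_root_char; apply/eigenvalueP.
  suff: exists2 v : 'rV_n.+1, v *m H = d 0 j *: v & v != 0 by rewrite de.
  exists (row j P).
    rewrite -row_mul {1}HE !mulmxA mulmxV // mul1mx row_mul row_diag_mx.
    by rewrite -scalemxAl -rowE.
  apply/eqP => r0; have := Pu; rewrite -row_free_unit.
  move=> /row_freeP[Q /(congr1 (row j))].
  rewrite row_mul r0 mul0mx => /rowP/(_ j); rewrite !mxE eqxx => /esym/eqP.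
  by rewrite oner_eq0.
have [q hq] := interp_seq (fun x => Num.sqrt (Num.sqrt x))
  [seq e j | j <- enum 'I_n.+1].
exists q; apply: (@map_mx_inj _ _ phi); rewrite -rmorphXn /= map_horner_mx.
rewrite -/H {1}HE horner_mx_uconjC // horner_mx_diag [RHS]HE.
congr (_ *m diag_mx _ *m _); apply/rowP => j; rewrite mxE de horner_map.
congr (phi _); rewrite horner_exp hq ?map_f ?mem_enum //.
by rewrite -[4%N]/(2 * 2)%N exprM sqr_sqrtr ?sqrtr_ge0 // sqr_sqrtr // ltW.
Qed.

Lemma trmx_horner_mx (R : realType) (n : nat) (A : 'M[R]_n.+1) (q : {poly R}) :
  A^T = A -> (horner_mx A q)^T = horner_mx A q.
Proof.
move=> hA; elim/poly_ind: q => [|p c hp]; first by rewrite rmorph0 trmx0.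
rewrite rmorphD rmorphM /= horner_mx_X horner_mx_C linearD /= tr_scalar_mx.
congr (_ + _); rewrite [LHS]trmx_mul hA hp.
exact: (comm_mx_horner p (comm_mx_refl A)).
Qed.

Lemma posdefmx_sqr (R : realType) (n : nat) (C : 'M[R]_n) :
  C^T = C -> C \in unitmx -> posdefmx (C *m C).
Proof.
move=> hC Cu; split=> [|x x0]; first by rewrite trmx_mul hC.
have := @dot_gt0 _ _ (x^T *m C); rewrite trmx_mul trmxK hC !mulmxA; apply.
apply: contra x0 => /eqP h; apply/eqP/trmx_inj.
by rewrite trmx0 -(mulmxK Cu x^T) h mul0mx.
Qed.

Lemma posdefmx_unit (R : realType) (n : nat) (A : 'M[R]_n) :
  posdefmx A -> A \in unitmx.
Proof.
move=> hA; rewrite -row_free_unit -kermx_eq0; apply/rowV0P => v /sub_kermxP vA.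
apply/eqP/negPn/negP => v0.
by have := posdefmx_row hA v0; rewrite vA mul0mx mxE ltxx.
Qed.

Lemma sqrtmx_exists (R : realType) (n : nat) (A : 'M[R]_n) :
  posdefmx A -> exists B : 'M[R]_n, posdefmx B /\ B *m B = A.
Proof.
case: n A => [|n] A hA; first by exists A; split=> //; apply/matrixP => -[].
have [q hq] := posdefmx_root4 hA; exists (horner_mx A q *m horner_mx A q).
have hB : horner_mx A q *m horner_mx A q *m (horner_mx A q *m horner_mx A q) = A.
  by rewrite -{5}hq -[4%N]/(2 * 2)%N exprM.
split=> //; apply: posdefmx_sqr; first exact: trmx_horner_mx hA.1.
have := posdefmx_unit hA; rewrite -{1}hB !unitmx_mul.
by case/andP => /andP[].
Qed.

Lemma sqrtmxP (R : realType) (n : nat) (A : 'M[R]_n) :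
  posdefmx A -> posdefmx (sqrtmx A) /\ sqrtmx A *m sqrtmx A = A.
Proof.
move=> /sqrtmx_exists h; rewrite /sqrtmx; case: xgetP => [B _ //|].
by case: h => B hB /(_ B).
Qed.

Lemma sqrtmx_uniq (R : realType) (n : nat) (A B : 'M[R]_n) :
  posdefmx B -> B *m B = A -> sqrtmx A = B.
Proof.
move=> hB <-; have Bu := posdefmx_unit hB.
have [hC] := sqrtmxP (posdefmx_sqr hB.1 Bu).
move: (sqrtmx _) hC => C hC CB; pose D := C - B.
have DT : D^T = D by rewrite /D linearB /= hC.1 hB.1.
have hD : D *m B + C *m D = 0.
  by rewrite /D mulmxBl mulmxBr CB addrC subrKA subrr.
have nneg E i : posdefmx E -> 0 <= (row i D *m E *m (row i D)^T) 0 0.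
  move=> hE; have [->|r0] := eqVneq (row i D) 0; first by rewrite !mul0mx mxE.
  exact/ltW/posdefmx_row.
have trE E : \tr (D *m E *m D) = \sum_i (row i D *m E *m (row i D)^T) 0 0.
  apply: eq_bigr => i _; rewrite tr_row DT -row_mul.
  by rewrite !mxE; apply: eq_bigr => k _; rewrite !mxE.
suff D0 : D = 0 by apply/eqP; rewrite -subr_eq0; apply/eqP.
have tr0 : \tr (D *m B *m D) + \tr (D *m C *m D) = 0.
  rewrite -[D *m C *m D]mulmxA [X in _ + X]mxtrace_mulC -mxtraceD -mulmxDl hD.
  by rewrite mul0mx mxtrace0.
have trge E : posdefmx E -> 0 <= \tr (D *m E *m D).
  by move=> hE; rewrite trE sumr_ge0 // => i _; exact: nneg.
move/eqP: tr0; rewrite paddr_eq0 ?trge // => /andP[/eqP tB _].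
move: tB; rewrite trE => /eqP; rewrite psumr_eq0 => [|i _]; last exact: nneg.
move=> /allP h; apply/row_matrixP => i; rewrite row0.
apply/eqP/negPn/negP => r0; have := h i (mem_index_enum _).
by rewrite gt_eqF // posdefmx_row.
Qed.

(* S.1 holds the locations of the cheap sensors, S.2 those of the expensive
   ones. *)
Definition selection (M : nat) : Type := ({set 'I_M} * {set 'I_M})%type.

Definition add_ch (M : nat) (S : selection M) (i : 'I_M) : selection M :=
  (i |: S.1, S.2).

Definition add_exp (M : nat) (S : selection M) (i : 'I_M) : selection M :=
  (S.1, i |: S.2).

Definition sel_mx (R : realType) (M : nat) (T : {set 'I_M}) : 'M[R]_(M, #|T|) :=
  colsub (fun c : 'I_#|T| => enum_val c) 1%:M.

Definition selection_mx (R : realType) (M : nat) (S : selection M) :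
    'M[R]_(M, #|S.1| + #|S.2|) :=
  row_mx (sel_mx R S.1) (sel_mx R S.2).

Definition noise_cov (R : realType) (s_ch s_exp : R) (M : nat)
    (S : selection M) : 'M[R]_(#|S.1| + #|S.2|) :=
  block_mx (s_ch ^+ 2)%:M 0 0 (s_exp ^+ 2)%:M.

Definition post_cov_inv (R : realType) (M l : nat) (Psi : 'M[R]_(M, l))
    (Spr : 'M[R]_l) (s_ch s_exp : R) (S : selection M) : 'M[R]_l :=
  Psi^T *m selection_mx R S *m invmx (noise_cov s_ch s_exp S)
    *m (selection_mx R S)^T *m Psi + invmx Spr.

Definition PhiD (R : realType) (M l : nat) (Psi : 'M[R]_(M, l))
    (Spr : 'M[R]_l) (s_ch s_exp : R) (S : selection M) : R :=
  ln (\det (sqrtmx Spr *m post_cov_inv Psi Spr s_ch s_exp S *m sqrtmx Spr)).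

(* Main.v *)
Require Import Defs.
From mathcomp Require Import all_boot all_order all_algebra.
From mathcomp Require Import reals exp.
Set Implicit Arguments.
Unset Strict Implicit.
Unset Printing Implicit Defensive.
Import Order.TTheory GRing.Theory Num.Theory.
Local Open Scope ring_scope.

(** Multiplying Psi by the transposed selection matrix picks rows of Psi, so the
    inverse posterior covariance is the prior precision plus one rank-one term
    per sensor: the outer square of the row of Psi at that location, weighted
    by the inverse noise variance ([post_cov_invE]).  Hence adding a sensor at
    the fresh location i turns the precision P of S into P + c r^T r, where r
    is row i of Psi, c = s_ch^-2 for a cheap sensor and c = s_exp^-2 for an
    expensive one; the second weight is the larger of the two.

    The matrix P is positive definite, so P = C C with C symmetric invertible,
    and with u = r C^-1 the matrix determinant lemma gives
      det (P + c r^T r) = (det C)^2 (1 + c |u|^2),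
    which is nondecreasing in c ([ler_det_add_outer]).  Conjugating by the
    square root of the prior covariance multiplies this determinant by a
    positive constant, and the logarithm is monotone on positive reals. *)

(** Sylvester's identity: both sides are the determinant of the same block
    matrix, computed by eliminating one or the other off-diagonal block. *)
Lemma det_add_mulmx_comm (R : comRingType) (m n : nat) (A : 'M[R]_(m, n))
    (B : 'M[R]_(n, m)) :
  \det (1%:M + A *m B) = \det (1%:M + B *m A).
Proof.
pose N := block_mx 1%:M (- A) B 1%:M.
have detl : \det N = \det (1%:M + A *m B).
  have -> : N = block_mx 1%:M (- A) 0 1%:M *m block_mx (1%:M + A *m B) 0 B 1%:M.
    rewrite mulmx_block !mul1mx !mul0mx !mulmx1 !add0r mulNmx.
    by rewrite addrK.
  by rewrite det_mulmx det_ublock det_lblock !det1 !mul1r mulr1.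
have detr : \det N = \det (1%:M + B *m A).
  have -> : N = block_mx 1%:M 0 B 1%:M *m block_mx 1%:M (- A) 0 (1%:M + B *m A).
    rewrite mulmx_block !mul1mx !mul0mx !mulmx1 !addr0 mulmxN.
    by rewrite addrC addrK.
  by rewrite det_mulmx det_ublock det_lblock !det1 !mul1r.
by rewrite -detl detr.
Qed.

Lemma det_posdefmx_gt0 (R : realType) (n : nat) (A : 'M[R]_n) :
  posdefmx A -> 0 < \det A.
Proof.
move=> hA; have [hB <-] := sqrtmxP hA.
rewrite det_mulmx -expr2 exprn_even_gt0 //= -unitfE.
exact: posdefmx_unit hB.
Qed.

(** The form of A^-1 at x is the form of A at A^-1 x. *)
Lemma posdefmx_invmx (R : realType) (n : nat) (A : 'M[R]_n) :
  posdefmx A -> posdefmx (invmx A).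
Proof.
move=> hA; have Au := posdefmx_unit hA.
split=> [|x x0]; first by rewrite trmx_inv hA.1.
have := hA.2 (invmx A *m x).
rewrite trmx_mul trmx_inv hA.1 !mulmxA mulmxKV //; apply.
by apply: contra x0 => /eqP h; rewrite -(mulKVmx Au x) h mulmx0.
Qed.

(** The added form x |-> c (r x)^2 is nonnegative. *)
Lemma posdefmx_add_outer (R : realType) (n : nat) (A : 'M[R]_n) (c : R)
    (r : 'rV[R]_n) :
  0 <= c -> posdefmx A -> posdefmx (A + c *: (r^T *m r)).
Proof.
move=> c0 hA; split=> [|x x0].
  by rewrite linearD linearZ /= trmx_mul trmxK hA.1.
rewrite mulmxDr mulmxDl mxE ltr_pwDl ?hA.2 //.
rewrite -scalemxAr -scalemxAl mxE mulr_ge0 // !mulmxA.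
by have := dot_ge0 (x^T *m r^T); rewrite trmx_mul !trmxK !mulmxA.
Qed.

Lemma posdefmx_add_outer_sum (R : realType) (n : nat) (I : Type) (s : seq I)
    (P : pred I) (c : R) (r : I -> 'rV[R]_n) (A : 'M[R]_n) :
  0 <= c -> posdefmx A ->
  posdefmx (A + c *: \sum_(k <- s | P k) (r k)^T *m r k).
Proof.
move=> c0; elim: s A => [|k s IH] A hA; first by rewrite big_nil scaler0 addr0.
rewrite big_cons; case: ifP => _; last exact: IH.
by rewrite scalerDr addrA; exact/IH/posdefmx_add_outer.
Qed.

(** A rank-one update of C C by c r^T r factors as C (1 + c u^T u) C with
    u = r C^-1; Sylvester's identity reduces the middle determinant to the
    scalar 1 + c |u|^2, which is affine in c with nonnegative slope. *)
Lemma ler_det_add_outer (R : realType) (n : nat) (A : 'M[R]_n) (a b : R)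
    (r : 'rV[R]_n) :
  posdefmx A -> a <= b ->
  \det (A + a *: (r^T *m r)) <= \det (A + b *: (r^T *m r)).
Proof.
move=> hA ab; have [hC <-] := sqrtmxP hA; set C := sqrtmx A in hC *.
have Cu := posdefmx_unit hC; pose u := r *m invmx C.
have detE c : \det (C *m C + c *: (r^T *m r)) =
    \det C ^+ 2 * (1 + c * (u *m u^T) 0 0).
  have -> : C *m C + c *: (r^T *m r) = C *m (1%:M + c *: u^T *m u) *m C.
    rewrite mulmxDr mulmxDl mulmx1 -scalemxAl -scalemxAr -scalemxAl.
    congr (_ + _ *: _).
    by rewrite /u trmx_mul trmx_inv hC.1 !mulmxA mulmxV // mul1mx mulmxKV.
  rewrite !det_mulmx det_add_mulmx_comm det_mx11 -scalemxAr !mxE mulrAC.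
  by rewrite -expr2.
rewrite !detE ler_wpM2l ?sqr_ge0 // lerD2l ler_wpM2r //.
exact: dot_ge0.
Qed.

(** The transposed selection matrix extracts the rows of Psi indexed by T, and
    a Gram matrix B^T B is the sum of the outer squares of the rows of B. *)
Lemma sel_mx_outer_sum (R : realType) (M l : nat) (Psi : 'M[R]_(M, l))
    (T : {set 'I_M}) :
  Psi^T *m sel_mx R T *m (sel_mx R T)^T *m Psi =
  \sum_(k in T) (row k Psi)^T *m row k Psi.
Proof.
have selE : (sel_mx R T)^T *m Psi = rowsub (fun c : 'I_#|T| => enum_val c) Psi.
  by rewrite /sel_mx trmx_mxsub trmx1 mul_rowsub_mx mul1mx.
rewrite -[Psi^T *m _]trmxK trmx_mul trmxK -mulmxA selE big_enum_val /=.
apply/matrixP => a b; rewrite mxE summxE; apply: eq_bigr => c _.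
by rewrite !mxE big_ord1 !mxE.
Qed.

(** In this additive form, adding a sensor to S adds a single summand, whereas
    the matrices in the definition of [post_cov_inv] change their size. *)
Lemma post_cov_invE (R : realType) (M l : nat) (Psi : 'M[R]_(M, l))
    (Spr : 'M[R]_l) (s_ch s_exp : R) (S : selection M) :
  s_ch != 0 -> s_exp != 0 ->
  post_cov_inv Psi Spr s_ch s_exp S =
  invmx Spr + s_ch ^- 2 *: \sum_(k in S.1) (row k Psi)^T *m row k Psi
            + s_exp ^- 2 *: \sum_(k in S.2) (row k Psi)^T *m row k Psi.
Proof.
move=> ch0 exp0; rewrite /post_cov_inv /selection_mx /noise_cov.
have Nu : block_mx (s_ch ^+ 2)%:M 0 0 (s_exp ^+ 2)%:M
    \in @unitmx R (#|S.1| + #|S.2|).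
  by rewrite unitmxE det_ublock !det_scalar unitfE mulf_neq0 ?expf_neq0.
rewrite invmx_block_diag // !invmx_scalar tr_row_mx mul_mx_row mul_row_block.
rewrite !mulmx0 addr0 add0r mul_row_col mulmxDl !mul_mx_scalar -!scalemxAl.
by rewrite !sel_mx_outer_sum addrC addrA.
Qed.

Theorem proposition3p3 (R : realType) (M l : nat) (hM : (1 <= M)%N)
    (hl : (1 <= l)%N) (Psi : 'M[R]_(M, l)) (Spr : 'M[R]_l)
    (hSpr : posdefmx Spr) (s_ch s_exp : R) (hexp : 0 < s_exp)
    (hch : s_exp < s_ch) (S : selection M) (hS : S.1 :&: S.2 = set0)
    (i : 'I_M) (hi : i \notin S.1 :|: S.2) :
  PhiD Psi Spr s_ch s_exp (add_ch S i) <= PhiD Psi Spr s_ch s_exp (add_exp S i).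
Proof.
have ch_gt0 : 0 < s_ch by exact: lt_trans hch.
have ch0 : s_ch != 0 by rewrite gt_eqF.
have exp0 : s_exp != 0 by rewrite gt_eqF.
have ch_ge0 : 0 <= s_ch ^- 2 by rewrite invr_ge0 sqr_ge0.
have exp_ge0 : 0 <= s_exp ^- 2 by rewrite invr_ge0 sqr_ge0.
move: hi; rewrite inE negb_or => /andP[i1 i2].
pose P := post_cov_inv Psi Spr s_ch s_exp S.
pose G := (row i Psi)^T *m row i Psi.
have chE : post_cov_inv Psi Spr s_ch s_exp (add_ch S i) = P + s_ch ^- 2 *: G.
  rewrite /P !post_cov_invE // big_setU1 //= scalerDr.
  by rewrite [s_ch ^- 2 *: _ + _]addrC addrA [LHS]addrAC.
have expE : post_cov_inv Psi Spr s_ch s_exp (add_exp S i) = P + s_exp ^- 2 *: G.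
  rewrite /P !post_cov_invE // big_setU1 //= scalerDr.
  by rewrite [s_exp ^- 2 *: _ + _]addrC addrA.
have hP : posdefmx P.
  rewrite /P post_cov_invE //.
  by do 2!apply: posdefmx_add_outer_sum => //; exact: posdefmx_invmx.
have [hB _] := sqrtmxP hSpr.
have B_gt0 := det_posdefmx_gt0 hB.
rewrite /PhiD chE expE !det_mulmx.
have det_gt0 c : 0 <= c -> 0 < \det (P + c *: G).
  by move=> c0; exact/det_posdefmx_gt0/posdefmx_add_outer.
rewrite ler_ln ?posrE ?mulr_gt0 ?det_gt0 //.
rewrite ler_pM2r // ler_pM2l //; apply: ler_det_add_outer => //.
by rewrite lef_pV2 ?posrE ?exprn_gt0 // lerXn2r ?nnegrE ?ltW.
Qed.
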